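(* Let $p$ be a zone tariff with metropolitan zone $Z_M$, increasing price function $P:\mathbb{N}_{\ge 1}\to\mathbb{R}_{\ge 0}$, whose underlying basic zone tariff satisfies the no-stopover property, and metropolitan price $P_M\in\mathbb{R}_{\ge 0}$. Consider the following algorithm for two stations $x,y\in V$: define edge weights $z_M(v,w)=0$ if $v,w\in Z_M$ and $z_M(v,w)=1$ otherwise, and compute a shortest $x$-$y$-path $W$ with respect to $z_M$; if $W$ has total weight $0$, return $W$; otherwise return a shortest $x$-$y$-path with respect to the zone border weights $b$. (i) If $P_M\le P(3)$, the algorithm computes a cheapest path from $x$ to $y$ and hence a cheapest standard ticket in polynomial time. (ii) If $P_M\le P(2)$ and $p$ satisfies the no-stopover property, then the algorithm yields a cheapest ticket from $x$ to $y$ (the standard ticket of the returned path) in polynomial time.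
   Context: ''Increasing'' means non-decreasing. A PTN is a finite, simple, connected, undirected graph $(V,E)$. A path is a finite sequence $(x_1,\dots,x_n)$, $n\ge 1$, of (not necessarily distinct) nodes with consecutive nodes adjacent; $\mathcal{W}$ is the set of all paths; $[x_i,x_j]$ denotes the subpath $(x_i,\dots,x_j)$. A zone partition $\mathcal{Z}$ is a partition of $V$ into nonempty sets called zones. The zone border weight of an edge $e=\{x,y\}$ is $b(e)=0$ if $x,y$ lie in the same zone and $b(e)=1$ otherwise; $z(W)=1+\sum_{i=1}^{n-1}b(x_i,x_{i+1})$ for a path $W=(x_1,\dots,x_n)$. The basic zone tariff with respect to $P$ is $W\mapsto P(z(W))$. A metropolitan zone is a union $Z_M=\bigcup_{Z\in\mathcal{Z}_M}Z$ for some $\mathcal{Z}_M\subseteq\mathcal{Z}$; it is assumed to contain at least one node and to be connected (its induced subgraph is connected). A path is included in $Z_M$ if all its nodes lie in $Z_M$. The zone tariff with metropolitan zone $Z_M$, price function $P$ and metropolitan price $P_M$ is the fare structure with $p(W)=P_M$ if $W$ is included in $Z_M$ and $p(W)=P(z(W))$ otherwise. No-stopover property: $p([x_1,x_n])\le p([x_1,x_i])+p([x_i,x_n])$ for all paths $(x_1,\dots,x_n)\in\mathcal{W}$, $n\ge 3$, $2\le i\le n-1$. A ticket of $W\in\mathcal{W}$ is a finite sequence of paths $T=(H_1,\dots,H_t)$ such that $W$ is a concatenation $W_1+\dots+W_t$ of subpaths with $W_j$ a subpath of $H_j$ for each $j$; its price is $\sum_{j=1}^t p(H_j)$. The standard ticket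 of $W$ is $(W)$. A cheapest ticket (resp. cheapest standard ticket) from $x$ to $y$ is one of minimum price among all tickets (resp. standard tickets) of all $x$-$y$-paths; a cheapest path from $x$ to $y$ is an $x$-$y$-path $W$ minimizing $p(W)$. *)

(* Defs.v *)
From mathcomp Require Import all_boot all_order all_algebra.
From mathcomp Require Import reals.

Set Implicit Arguments.
Unset Strict Implicit.
Unset Printing Implicit Defensive.

Import Order.TTheory GRing.Theory Num.Theory.
Local Open Scope ring_scope.

Section Network.
Context (V : finType) (e : rel V).

Definition ptn : Prop :=
  [/\ symmetric e, irreflexive e & forall x y, connect e x y].

(* Nodes may be repeated: this is a walk in graph-theoretic terminology. *)
Definition is_path (W : seq V) : bool :=
  if W is x :: s then path e x s else false.

Definition xy_path (x y : V) (W : seq V) : bool :=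
  is_path W && (ohead W == Some x) && (last x W == y).

(* [x_i, x_j] for 1-based indices 1 <= i <= j <= size W. *)
Definition subpath (W : seq V) (i j : nat) : seq V := drop i.-1 (take j W).

Definition is_subpath (U H : seq V) : bool := (U != [::]) && infix U H.

(* Consecutive summands share their junction node:
   (x_1, .., x_i) + (x_i, .., x_n) = (x_1, .., x_n). *)
Inductive concatenation : seq (seq V) -> seq V -> Prop :=
| ConcatOne W : W != [::] -> concatenation [:: W] W
| ConcatCons s x s' Ws :
    concatenation Ws (x :: s') ->
    concatenation (rcons s x :: Ws) (s ++ x :: s').

(* [all2] also forces the number of summands to be the number of tickets. *)
Definition is_ticket (W : seq V) (T : seq (seq V)) : Prop :=
  all is_path T /\ exists2 Ws, concatenation Ws W & all2 is_subpath Ws T.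

Definition standard_ticket (W : seq V) : seq (seq V) := [:: W].

Definition path_weight (w : V -> V -> nat) (W : seq V) : nat :=
  (\sum_(uv <- zip W (behead W)) w uv.1 uv.2)%N.

Definition shortest_path (w : V -> V -> nat) (x y : V) (W : seq V) : Prop :=
  xy_path x y W /\
  forall W', xy_path x y W' -> (path_weight w W <= path_weight w W')%N.

(* A fare structure is only meaningful on lists satisfying [is_path]. *)
Section Fares.
Context (R : realType) (p : seq V -> R).

Definition no_stopover : Prop :=
  forall W i, is_path W -> (3 <= size W)%N -> (2 <= i <= (size W).-1)%N ->
    p (subpath W 1 (size W)) <= p (subpath W 1 i) + p (subpath W i (size W)).

Definition ticket_price (T : seq (seq V)) : R := \sum_(H <- T) p H.

Definition cheapest_path (x y : V) (W : seq V) : Prop :=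
  xy_path x y W /\ forall W', xy_path x y W' -> p W <= p W'.

Definition cheapest_ticket (x y : V) (T : seq (seq V)) : Prop :=
  (exists2 W, xy_path x y W & is_ticket W T) /\
  forall W' T', xy_path x y W' -> is_ticket W' T' ->
    ticket_price T <= ticket_price T'.

Definition cheapest_standard_ticket (x y : V) (T : seq (seq V)) : Prop :=
  (exists2 W, xy_path x y W & T = standard_ticket W) /\
  forall W', xy_path x y W' ->
    ticket_price T <= ticket_price (standard_ticket W').

End Fares.

Definition zone_partition (Z : {set {set V}}) : bool := partition Z [set: V].

Definition border_weight (Z : {set {set V}}) (u v : V) : nat :=
  if pblock Z u == pblock Z v then 0%N else 1%N.

Definition zones (Z : {set {set V}}) (W : seq V) : nat :=
  (1 + path_weight (border_weight Z) W)%N.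

(* Price functions are defined on positive integers only; the value at 0 is
   never used since [zones Z W] is positive. *)
Definition basic_zone_tariff (R : realType) (Z : {set {set V}}) (P : nat -> R)
  (W : seq V) : R := P (zones Z W).

Definition induced_connected (S : {set V}) : Prop :=
  forall u v, u \in S -> v \in S ->
    connect [rel a b | [&& e a b, a \in S & b \in S]] u v.

Definition metropolitan_zone (Z : {set {set V}}) (ZM : {set V}) : Prop :=
  [/\ exists2 ZMs : {set {set V}}, ZMs \subset Z & ZM = cover ZMs,
      ZM != set0 & induced_connected ZM].

Definition metropolitan_tariff (R : realType) (Z : {set {set V}})
    (ZM : {set V}) (P : nat -> R) (PM : R) (W : seq V) : R :=
  if all [in ZM] W then PM else P (zones Z W).

Definition metropolitan_weight (ZM : {set V}) (u v : V) : nat :=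
  if (u \in ZM) && (v \in ZM) then 0%N else 1%N.

(* [algorithm_returns Z ZM x y W] : W is a possible result of the algorithm on
   stations x, y.  It is a relation because ties between shortest paths are
   broken arbitrarily. *)
Inductive algorithm_returns (Z : {set {set V}}) (ZM : {set V}) (x y : V) :
  seq V -> Prop :=
| ReturnMetropolitan W :
    shortest_path (metropolitan_weight ZM) x y W ->
    path_weight (metropolitan_weight ZM) W = 0%N ->
    algorithm_returns Z ZM x y W
| ReturnZone W W' :
    shortest_path (metropolitan_weight ZM) x y W ->
    path_weight (metropolitan_weight ZM) W <> 0%N ->
    shortest_path (border_weight Z) x y W' ->
    algorithm_returns Z ZM x y W'.

End Network.

Definition increasing_price (R : realType) (P : nat -> R) : Prop :=
  forall m n : nat, (1 <= m)%N -> (m <= n)%N -> P m <= P n.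

Definition nonneg_price (R : realType) (P : nat -> R) : Prop :=
  forall n : nat, (1 <= n)%N -> 0 <= P n.

(* Structured random access machine programs with uniform cost, over registers
  and indirectly addressed arrays of natural numbers.  The arithmetic is
  addition and truncated subtraction only; there is no multiplication, so
  that values reached in t steps have O(t + input length) bits and
  polynomial time here is polynomial time on a Turing machine. *)

Inductive expr :=
| Lit of nat
| Reg of nat
| Get of nat & expr
| Add of expr & expr
| Sub of expr & expr.

Inductive com :=
| Skip
| SetReg of nat & expr
| SetArr of nat & expr & expr
| Seq of com & com
| If of expr & com & com
| While of expr & com.

Record state := State { reg : nat -> nat; arr : nat -> nat -> nat }.

Definition set_reg (s : state) (r v : nat) : state :=
  State (fun r' => if r' == r then v else reg s r') (arr s).

Definition set_arr (s : state) (a i v : nat) : state :=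
  State (reg s)
    (fun a' i' => if (a' == a) && (i' == i) then v else arr s a' i').

Fixpoint eval (s : state) (E : expr) : nat :=
  match E with
  | Lit n => n
  | Reg r => reg s r
  | Get a E1 => arr s a (eval s E1)
  | Add E1 E2 => (eval s E1 + eval s E2)%N
  | Sub E1 E2 => (eval s E1 - eval s E2)%N
  end.

Fixpoint cost (E : expr) : nat :=
  match E with
  | Lit _ | Reg _ => 1%N
  | Get _ E1 => (cost E1).+1
  | Add E1 E2 | Sub E1 E2 => (cost E1 + cost E2).+1
  end.

(* [exec c s t s'] : started in state s, the program c halts in state s' after
   exactly t steps.  A test succeeds when its value is nonzero. *)
Inductive exec : com -> state -> nat -> state -> Prop :=
| ExecSkip s : exec Skip s 1 s
| ExecSetReg s r E :
    exec (SetReg r E) s (cost E).+1 (set_reg s r (eval s E))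
| ExecSetArr s a E1 E2 :
    exec (SetArr a E1 E2) s (cost E1 + cost E2).+1
         (set_arr s a (eval s E1) (eval s E2))
| ExecSeq c1 c2 s s1 s2 t1 t2 :
    exec c1 s t1 s1 -> exec c2 s1 t2 s2 ->
    exec (Seq c1 c2) s (t1 + t2).+1 s2
| ExecIf E c1 c2 s s' t :
    exec (if eval s E != 0%N then c1 else c2) s t s' ->
    exec (If E c1 c2) s (cost E + t).+1 s'
| ExecWhileStop E c s :
    eval s E = 0%N -> exec (While E c) s (cost E).+1 s
| ExecWhileStep E c s s1 s2 t1 t2 :
    eval s E <> 0%N -> exec c s t1 s1 -> exec (While E c) s1 t2 s2 ->
    exec (While E c) s (cost E + t1 + t2).+1 s2.

Section Encoding.
Context (V : finType).

Definition code (v : V) : nat := index v (enum V).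

(* Initial memory for the instance (V, e, Z, ZM, x, y).
   Registers 0, 1, 2: number of nodes, code of x, code of y.
   Array 0: adjacency matrix, row by row; array 1: number of the zone of each
   node; array 2: membership of each node in ZM.  All other cells are 0. *)
Definition input (e : rel V) (Z : {set {set V}}) (ZM : {set V}) (x y : V) :
  state :=
  State (nth 0%N [:: #|V|; code x; code y])
    (fun a => nth 0%N (nth [::]
       [:: [seq nat_of_bool (e u v) | u <- enum V, v <- enum V];
           [seq index (pblock Z v) (enum Z) | v <- enum V];
           [seq nat_of_bool (v \in ZM) | v <- enum V]] a)).

(* The result is read off array 0, its length being in register 0. *)
Definition outputs (s : state) (W : seq V) : Prop :=
  mkseq (arr s 0) (reg s 0) = map code W.

End Encoding.

(* Main.v *)
Require Import Defs.
From mathcomp Require Import all_boot all_order all_algebra.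
From mathcomp Require Import reals zify.
(* Imported again so that [Sub] denotes subtraction of program expressions. *)
Import Defs.

(** Whether a path of weight 0 for the metropolitan weight exists depends only on
    the stations: it does if and only if [x = y] or both stations lie in the
    metropolitan zone, which is connected ([shortest_metropolitan_weight0]).

    Prices.  A path that leaves the metropolitan zone and returns to it crosses
    at least two zone borders, since the metropolitan zone is a union of zones;
    so it costs at least [P 3].  If [PM <= P 3], then for two metropolitan stations
    a path inside the metropolitan zone is cheapest.  If one of the stations is
    not metropolitan, no path between them gets the metropolitan price, and since
    [P] is increasing a path crossing fewest borders is cheapest.  This is (i), see
    [price_cheapest].  For (ii), if [PM <= P 2] then a subpath is never more
    expensive than the path containing it ([price_infix]), so the tickets of a
    journey cost at least as much as the pieces of the path that they cover; by the
    no-stopover property the pieces cost at least as much as the path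
    ([price_concatenation]), and (i) applies.

    Polynomial time.  By the first remark, both phases of the algorithm can be
    merged: a flag computed from the stations selects one of the two edge weights,
    and one run of Dijkstra's algorithm towards [y] with the selected weight gives
    a path that the algorithm may return.  The program settles one node per round,
    choosing among all edges from an unsettled to a settled node one that minimizes
    the resulting distance; zero weights do no harm because the successor of a node
    has been settled before it.  The invariant is [settled], its preservation
    [settled_step] rests on [crossing_bound], and after [#|V|] rounds every node is
    settled because the network is connected.  Each round scans the whole adjacency
    matrix, whence a cubic time bound. *)

Set Implicit Arguments.
Unset Strict Implicit.
Unset Printing Implicit Defensive.

Import Order.TTheory GRing.Theory Num.Theory.

(** * Path weights *)
Lemma xy_pathP (V : finType) (e : rel V) x y W :
  reflect (exists2 p, W = x :: p & path e x p /\ last x p = y) (xy_path e x y W).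
Proof.
rewrite /xy_path; case: W => [|a p] /=; first by constructor=> -[].
apply: (iffP andP) => [[/andP[ep /eqP[<-]] /eqP<-]|[_ [<- <-] [-> ->]]].
  by exists p.
by rewrite !eqxx.
Qed.

Section PathWeight.
Context (V : finType) (w : V -> V -> nat).

Lemma path_weight1 v : path_weight w [:: v] = 0.
Proof. by rewrite /path_weight big_nil. Qed.

Lemma path_weight_cons u v W :
  path_weight w [:: u, v & W] = w u v + path_weight w (v :: W).
Proof. by rewrite /path_weight /= big_cons. Qed.

Lemma path_weight_infix U W : infix U W -> path_weight w U <= path_weight w W.
Proof.
have le_cons v S : path_weight w S <= path_weight w (v :: S).
  case: S => [|u S]; first by rewrite /path_weight big_nil.
  by rewrite path_weight_cons leq_addl.
have le_cat S T : path_weight w S <= path_weight w (S ++ T).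
  elim: S => [|v [|u S] IH]; first by rewrite /path_weight big_nil.
    by rewrite path_weight1.
  by rewrite /= !path_weight_cons leq_add2l.
case/infixP => S [T ->]; elim: S => [|v S IH] //=.
exact: leq_trans IH (le_cons _ _).
Qed.

(** Membership in [M] can only change along an edge of positive weight. *)
Lemma path_weight_constant (M : {set V}) W :
    (forall u v, w u v = 0 -> (u \in M) = (v \in M)) ->
    path_weight w W = 0 ->
  {in W &, forall u v, (u \in M) = (v \in M)}.
Proof.
move=> wM; case: W => [|a W] // W0.
suff aW : {in a :: W, forall u, (u \in M) = (a \in M)} by move=> u v /aW-> /aW->.
elim: W a W0 => [|b W IH] a; first by move=> _ u; rewrite inE => /eqP->.
rewrite path_weight_cons => /eqP; rewrite addn_eq0 => /andP[/eqP ab0 /eqP W0] u.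
by rewrite inE => /predU1P[->//|/(IH _ W0)->]; rewrite (wM a b).
Qed.

(** Leaving [M] and coming back uses two edges of positive weight: the first
    edge that leaves [M], and one on the way back. *)
Lemma path_weight_return (M : {set V}) a W :
    (forall u v, w u v = 0 -> (u \in M) = (v \in M)) ->
    a \in M -> last a W \in M -> ~~ all [in M] (a :: W) ->
  2 <= path_weight w (a :: W).
Proof.
move=> wM; elim: W a => [|b W IH] a aM; first by rewrite /= aM.
rewrite [last _ _]/= [all _ _]/= aM /= => lM out.
rewrite path_weight_cons; case: (boolP (b \in M)) => bM.
  by rewrite (leq_trans (IH b bM lM out)) ?leq_addl.
have ab : 0 < w a b.
  by rewrite lt0n; apply/negP => /eqP /wM; rewrite aM (negPf bM).
have bW : 0 < path_weight w (b :: W).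
  rewrite lt0n; apply/negP => /eqP /(path_weight_constant wM) /(_ b (last b W)).
  by rewrite mem_head mem_last (negPf bM) lM => /(_ isT isT).
by lia.
Qed.

Lemma shortest_path_exists (e : rel V) x y :
  connect e x y -> exists W, shortest_path e w x y W.
Proof.
case/connectP => p ep ly.
have xyW : xy_path e x y (x :: p) by rewrite /xy_path /= ep ly !eqxx.
move: {2}(path_weight w (x :: p)) (leqnn (path_weight w (x :: p))) => m.
elim: m (x :: p) xyW => [|m IH] W xyW Wm.
  by exists W; split=> // W' _; apply: leq_trans Wm _.
have [[W' [xyW' W'm]]|no] := boolp.pselect
    (exists W', xy_path e x y W' /\ path_weight w W' <= m); first exact: IH W'm.
exists W; split=> // W' xyW'; rewrite leqNgt; apply/negP => lt; case: no.
by exists W'; split=> //; rewrite -ltnS (leq_trans lt).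
Qed.

End PathWeight.

(** * Prices of paths and tickets *)
Section Fares.
Context (R : realType) (V : finType) (e : rel V) (Z : {set {set V}}).
Context (ZM : {set V}) (P : nat -> R) (PM : R).
Hypotheses (part : zone_partition Z) (metro : metropolitan_zone e Z ZM).
Hypotheses (incP : increasing_price P) (geP : nonneg_price P).
Hypothesis PM0 : (0 <= PM)%R.
Let p := metropolitan_tariff Z ZM P PM.

(** The metropolitan zone is a union of zones, so an edge that enters or leaves
    it crosses a zone border. *)
Lemma border_weight0_metro u v :
  border_weight Z u v = 0 -> (u \in ZM) = (v \in ZM).
Proof.
rewrite /border_weight; case: eqP => // same _.
have [coverZ trivZ _] := and3P part.
have [[Zs sub ->] _ _] := metro.
suff half a b : pblock Z a = pblock Z b -> a \in cover Zs -> b \in cover Zs.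
  by apply/idP/idP; apply: half.
move=> ab /bigcupP[B BZs aB]; apply/bigcupP; exists B => //.
rewrite -(def_pblock trivZ (subsetP sub B BZs) aB) ab mem_pblock.
by rewrite (eqP coverZ) inE.
Qed.

Lemma metropolitan_weight0 a q :
  path_weight (metropolitan_weight ZM) (a :: q) = 0 ->
  q = [::] \/ all [in ZM] (a :: q).
Proof.
case: q => [|b q] H; [by left | right].
elim: q a b H => [|c q IH] a b; rewrite path_weight_cons => /eqP;
  rewrite addn_eq0 {1}/metropolitan_weight => /andP[].
  by case: ifP => // /andP[aM bM] _ _ /=; rewrite aM bM.
by case: ifP => // /andP[aM bM] _ /eqP /IH /=; rewrite aM.
Qed.

Lemma metropolitan_weight_in W :
  all [in ZM] W -> path_weight (metropolitan_weight ZM) W = 0.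
Proof.
elim: W => [|a [|b W] IH]; rewrite ?path_weight1 //.
  by rewrite /path_weight big_nil.
rewrite path_weight_cons => /andP[aM bW]; rewrite IH // /metropolitan_weight aM.
by case/andP: bW => /= ->.
Qed.

(** This is what the first phase of the algorithm really tests.  The case
    [x == y] is there because the one-node path has weight 0 wherever it lies;
    the other case uses that [ZM] is connected. *)
Lemma shortest_metropolitan_weight0 x y W :
    shortest_path e (metropolitan_weight ZM) x y W ->
  (path_weight (metropolitan_weight ZM) W == 0) =
    (x == y) || (x \in ZM) && (y \in ZM).
Proof.
move=> [/xy_pathP[q -> [eq lq]] minW]; apply/eqP/idP.
  case/metropolitan_weight0 => [q0|allM]; first by rewrite -lq q0 eqxx.
  rewrite -lq !(allP allM) ?mem_head ?orbT //; exact: mem_last.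
case/orP => [/eqP xy|/andP[xM yM]]; apply/eqP; rewrite -leqn0.
  rewrite -(path_weight1 (metropolitan_weight ZM) x).
  by apply: minW; apply/xy_pathP; exists [::]; rewrite ?xy.
have [_ _ /(_ x y xM yM) /connectP[r er ly]] := metro.
have rM : all [in ZM] (x :: r).
  rewrite /= xM /=; elim: r (x) er {ly} => //= b r IH a.
  by case/andP=> /and3P[_ _ ->] /IH.
rewrite -(metropolitan_weight_in rM); apply: minW; apply/xy_pathP; exists r => //.
by split=> //; apply: sub_path er => a b /= /and3P[].
Qed.

(** Between two nodes of [ZM] a path either stays in [ZM] and costs [PM], or it
    leaves and returns, meets at least three zones and costs at least
    [P 3 >= PM].  For all other pairs of stations every path pays the zone price,
    which is smallest when fewest borders are crossed. *)
Lemma price_cheapest x y W :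
    (PM <= P 3)%R -> algorithm_returns e Z ZM x y W ->
  cheapest_path e p x y W.
Proof.
move=> PM3 [{}W shW /eqP W0 | W0 {}W shW0 /eqP W0n shW].
  have := W0; rewrite (shortest_metropolitan_weight0 shW) => xyM.
  have [xyW _] := shW; split=> // W' /xy_pathP[r -> [er lr]].
  have /xy_pathP[q Wq [eq lq]] := xyW.
  case: (boolP ((x \in ZM) && (y \in ZM))) => [/andP[xM yM]|nM].
    have -> : p W = PM.
      rewrite /p /metropolitan_tariff; move/eqP: W0; rewrite Wq.
      by case/metropolitan_weight0 => [->|->] //=; rewrite xM.
    rewrite /p /metropolitan_tariff; case: ifP => // /negbT out.
    apply: le_trans PM3 (incP _ _) => //; rewrite /zones add1n ltnS.
    by apply: (path_weight_return border_weight0_metro); rewrite ?lr.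
  have xN : x \notin ZM.
    by move: xyM; rewrite (negPf nM) orbF => /eqP xy; rewrite -xy andbb in nM.
  rewrite /p /metropolitan_tariff [all _ (x :: r)]/= (negPf xN) /=.
  have -> : W = [:: x].
    rewrite Wq; move/eqP: W0; rewrite Wq => /metropolitan_weight0[->//|/=].
    by rewrite (negPf xN).
  rewrite /= (negPf xN) /=; apply: incP => //.
  by rewrite /zones path_weight1.
have nM : ~~ ((x \in ZM) && (y \in ZM)).
  by move: W0n; rewrite (shortest_metropolitan_weight0 shW0) negb_or => /andP[].
have out U : xy_path e x y U -> p U = P (zones Z U).
  case/xy_pathP => r -> [_ lr]; rewrite /p /metropolitan_tariff.
  case: ifP => // /allP allM; case/negP: nM.
  by rewrite -lr !allM ?mem_head ?mem_last.
have [xyW minW] := shW; split=> // W' xyW'; rewrite !out //.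
by apply: incP => //; rewrite leq_add2l minW.
Qed.

Lemma price_ge0 W : (0 <= p W)%R.
Proof.
by rewrite /p /metropolitan_tariff; case: ifP => // _; apply: geP.
Qed.

(** The metropolitan price can only break the monotonicity of [P] when [U] lies
    in [ZM] and [H] does not; then [H] meets at least two zones and costs at least
    [P 2 >= PM]. *)
Lemma price_infix U H :
    (PM <= P 2)%R -> U != [::] -> infix U H -> (p U <= p H)%R.
Proof.
move=> PM2 U0 UH; rewrite /p /metropolitan_tariff.
have subUH := mem_infix UH.
have [inU|outU] := boolP (all [in ZM] U);
  have [inH|outH] := boolP (all [in ZM] H) => //.
- apply: le_trans PM2 (incP _ _) => //; rewrite /zones add1n ltnS lt0n.
  apply/negP => /eqP /(path_weight_constant border_weight0_metro) sameM.
  case: U U0 inU subUH {UH} => // a U _ /andP[aM _] /(_ a (mem_head _ _)) aH.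
  have /allPn[b bH bN] := outH.
  by case/negP: bN; rewrite -(sameM a b).
- case/negP: outU; apply/allP => a /subUH; exact: (allP inH).
by apply: incP; rewrite // /zones leq_add2l path_weight_infix.
Qed.

(** The no-stopover property speaks of splits into two parts with at least one
    edge each.  When one part is a single node, the other part is the whole path
    and nonnegativity of prices is enough. *)
Lemma price_concatenation Ws W :
    no_stopover e p -> concatenation Ws W -> is_path e W ->
  (p W <= ticket_price p Ws)%R.
Proof.
move=> nsp; elim=> {Ws W} [W _ _|s x s' Ws _ IH eW].
  by rewrite /ticket_price big_seq1.
have {}IH : (p (x :: s') <= ticket_price p Ws)%R.
  by apply: IH; move: eW; case: s => //= a s; rewrite cat_path /= => /and3P[].
rewrite /ticket_price big_cons; apply: le_trans (lerD (lexx _) IH).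
case: s eW => [|a s] eW; first by rewrite lerDr price_ge0.
case: s' eW {IH} => [|b s'] eW; first by rewrite cats1 lerDl price_ge0.
have := nsp _ (size s).+2 eW; rewrite /subpath take_size drop0 /=.
rewrite !size_cat /= !addnS !ltnS => /(_ isT); rewrite leq_addr => /(_ isT).
by rewrite drop_size_cat // -cat_rcons take_size_cat ?size_rcons.
Qed.

(** Any ticket is at least as expensive as the pieces that it covers, these cost
    together at least as much as the whole path, and the path returned by the
    algorithm is a cheapest one. *)
Lemma price_cheapest_ticket x y W :
    (PM <= P 2)%R -> no_stopover e p -> algorithm_returns e Z ZM x y W ->
  cheapest_ticket e p x y (standard_ticket W).
Proof.
move=> PM2 nsp algW.
have PM3 : (PM <= P 3)%R by apply: le_trans PM2 (incP _ _).
have [xyW minW] := price_cheapest PM3 algW.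
have eqW : is_path e W by case/andP: xyW => /andP[].
have W0 : W != [::] by case: (W) eqW.
split.
  exists W => //; split; first by rewrite /= eqW.
  exists [:: W]; first exact: ConcatOne.
  by rewrite /= /is_subpath W0 infix_refl.
move=> W' T' xyW' [_ [Ws cat sub]].
rewrite /ticket_price big_seq1; apply: le_trans (minW _ xyW') _.
apply: le_trans (price_concatenation nsp cat _) _.
  by case/andP: xyW' => /andP[].
rewrite /ticket_price; elim: Ws T' sub {cat} => [|U Ws IH] [|H T] //=.
case/andP=> /andP[U0 UH] /IH le; rewrite !big_cons lerD //.
exact: price_infix.
Qed.

End Fares.

(** * Timed execution of programs *)
(** A total-correctness triple with a time bound: [c] halts from [s] within [T]
    steps in a state satisfying [Q]. *)
Definition runs (c : com) (T : nat) (s : state) (Q : state -> Prop) : Prop :=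
  exists t s', [/\ exec c s t s', t <= T & Q s'].

Lemma runs_weaken c T T' s (Q Q' : state -> Prop) :
  T <= T' -> (forall s', Q s' -> Q' s') -> runs c T s Q -> runs c T' s Q'.
Proof.
move=> TT' QQ' [t [s' [ex tT q]]]; exists t, s'.
by split=> //; [apply: leq_trans TT' | apply: QQ'].
Qed.

(** The first goal left by this lemma is solved by following the program, which
    also computes [T]; the bound is checked afterwards. *)
Lemma runs_time c T T' s (Q : state -> Prop) :
  runs c T s Q -> T <= T' -> runs c T' s Q.
Proof. by move=> run TT'; apply: runs_weaken run. Qed.

Lemma runs_skip s (Q : state -> Prop) : Q s -> runs Skip 1 s Q.
Proof. by exists 1, s; split=> //; constructor. Qed.

Lemma runs_set_reg r E s (Q : state -> Prop) :
  Q (set_reg s r (eval s E)) -> runs (SetReg r E) (cost E).+1 s Q.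
Proof. by eexists _, _; split; [constructor | | eassumption]. Qed.

Lemma runs_set_arr a E1 E2 s (Q : state -> Prop) :
    Q (set_arr s a (eval s E1) (eval s E2)) ->
  runs (SetArr a E1 E2) (cost E1 + cost E2).+1 s Q.
Proof. by eexists _, _; split; [constructor | | eassumption]. Qed.

Lemma runs_seq c1 c2 T1 T2 s (Q : state -> Prop) :
  runs c1 T1 s (fun s1 => runs c2 T2 s1 Q) -> runs (Seq c1 c2) (T1 + T2).+1 s Q.
Proof.
move=> [t1 [s1 [ex1 tT1 [t2 [s2 [ex2 tT2 q]]]]]]; exists (t1 + t2).+1, s2.
by split=> //; [apply: ExecSeq ex1 ex2 | rewrite ltnS leq_add].
Qed.

Lemma runs_if E c1 c2 T1 T2 s (Q : state -> Prop) :
    (eval s E <> 0 -> runs c1 T1 s Q) -> (eval s E = 0 -> runs c2 T2 s Q) ->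
  runs (If E c1 c2) (cost E + (T1 + T2)).+1 s Q.
Proof.
move=> H1 H2; have [E0|/eqP E0] := eqVneq (eval s E) 0.
  have [t [s' [ex tT q]]] := H2 E0; exists (cost E + t).+1, s'; split=> //.
    by constructor; rewrite E0.
  by rewrite ltnS leq_add2l (leq_trans tT) ?leq_addl.
have [t [s' [ex tT q]]] := H1 E0; exists (cost E + t).+1, s'; split=> //.
  by constructor; move/eqP: E0 => ->.
by rewrite ltnS leq_add2l (leq_trans tT) ?leq_addr.
Qed.

Lemma runs_while_stop E c s (Q : state -> Prop) :
  eval s E = 0 -> Q s -> runs (While E c) (cost E).+1 s Q.
Proof. by exists (cost E).+1, s; split=> //; apply: ExecWhileStop. Qed.

Lemma runs_while_step E c T1 T2 s (Q : state -> Prop) :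
    eval s E <> 0 -> runs c T1 s (fun s1 => runs (While E c) T2 s1 Q) ->
  runs (While E c) (cost E + T1 + T2).+1 s Q.
Proof.
move=> E0 [t1 [s1 [ex1 tT1 [t2 [s2 [ex2 tT2 q]]]]]].
exists (cost E + t1 + t2).+1, s2; split=> //.
  exact: ExecWhileStep ex1 ex2.
by rewrite ltnS leq_add ?leq_add2l.
Qed.

Definition for_loop (r : nat) (c : com) : com :=
  Seq (SetReg r (Lit 0))
    (While (Sub (Reg 0) (Reg r)) (Seq c (SetReg r (Add (Reg r) (Lit 1))))).

(** The invariant is stated at the loop test and has to fix the values of the
    counter and of the bound, on which the body may then rely.  A round
    costs 9 steps on top of the body: 4 for the test, 4 for the increment and 1
    for the sequencing. *)
Lemma runs_for r c T n s (Inv : nat -> state -> Prop) :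
    (forall i s, Inv i s -> reg s 0 = n /\ reg s r = i) ->
    Inv 0 (set_reg s r 0) ->
    (forall i s, i < n -> Inv i s ->
      runs c T s (fun s' => reg s' r = i /\ Inv i.+1 (set_reg s' r i.+1))) ->
  runs (for_loop r c) (n * (T + 9) + 7) s (Inv n).
Proof.
move=> regs inv0 body.
apply: (@runs_weaken _ (2 + (n * (T + 9) + 4)).+1 _ _ (Inv n)) => //.
  by lia.
apply: runs_seq; apply: runs_set_reg => /=.
suff loop m i s1 : n - i <= m -> i <= n -> Inv i s1 ->
    runs (While (Sub (Reg 0) (Reg r)) (Seq c (SetReg r (Add (Reg r) (Lit 1)))))
      (m * (T + 9) + 4) s1 (Inv n).
  by apply: (loop n 0); rewrite ?subn0.
have stop j s2 : j = n -> Inv j s2 -> runs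
    (While (Sub (Reg 0) (Reg r)) (Seq c (SetReg r (Add (Reg r) (Lit 1))))) 4 s2
    (Inv n).
  move=> in_ inv; apply: runs_while_stop; last by rewrite -in_.
  by have [n0 rj] := regs _ _ inv; rewrite /= n0 rj in_ subnn.
elim: m i s1 => [|m IH] i s1 mi le_in inv; first by apply: stop inv; lia.
have [in_|lt_in] := eqVneq i n.
  by apply: runs_weaken (stop _ _ in_ inv) => //; lia.
have {}lt_in : i < n by lia.
have [n0 ri] := regs _ _ inv.
apply: (@runs_weaken _ (3 + (T + 4).+1 + (m * (T + 9) + 4)).+1 _ _ (Inv n)) => //.
  by lia.
apply: (runs_while_step (E := Sub (Reg 0) (Reg r))); first by rewrite /= n0 ri; lia.
apply: runs_seq; apply: runs_weaken (body _ _ lt_in inv) => // s2 [ri2 inv2].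
by apply: runs_set_reg; rewrite /= ri2 addn1; apply: IH inv2 => //; lia.
Qed.

(** * The program *)
Definition gap (E1 E2 : expr) : expr := Add (Sub E1 E2) (Sub E2 E1).

Lemma eval_gap s E1 E2 :
  (eval s (gap E1 E2) == 0) = (eval s E1 == eval s E2).
Proof. by rewrite /=; lia. Qed.

(** Register 3 holds a flag [F]; the weight is the metropolitan weight when
    [F = 1] and the zone border weight when [F = 0].  Since [a - (1 - F)] and
    [b - F] with truncated subtraction erase the unwanted one of two bits, a case
    distinction without branching or multiplication results. *)
Definition edge_weight : expr :=
  Add (Sub (Sub (Lit 1) (Sub (Add (Get 2 (Reg 5)) (Get 2 (Reg 7))) (Lit 1)))
           (Sub (Lit 1) (Reg 3)))
      (Sub (Sub (Lit 1) (Sub (Lit 1) (gap (Get 1 (Reg 5)) (Get 1 (Reg 7)))))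
           (Reg 3)).

(** Register use: 4 round, 5 and 7 the two nodes [u] and [v] of the current pair,
    6 the offset of row [u] in the adjacency matrix, 8 the best value so far, 9
    and 10 the edge attaining it, 13 the value of the current edge.  Array 3 holds
    one plus the distance to the target for settled nodes and 0 for the others,
    so that the initial contents of memory mean that nothing is settled; likewise
    0 in register 8 means that no edge has been found.  Array 4 holds the
    successor of a settled node. *)
Definition scan_edge : com :=
  If (Get 0 (Add (Reg 6) (Reg 7)))
    (If (Get 3 (Reg 5)) Skip
      (If (Get 3 (Reg 7))
        (Seq (SetReg 13 (Add (Get 3 (Reg 7)) edge_weight))
          (If (Add (Sub (Lit 1) (Reg 8)) (Sub (Reg 8) (Reg 13)))
            (Seq (SetReg 8 (Reg 13))
              (Seq (SetReg 9 (Reg 5)) (SetReg 10 (Reg 7))))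
            Skip))
        Skip))
    Skip.

Definition settle_best : com :=
  If (Reg 8)
    (Seq (SetArr 3 (Reg 9) (Reg 8)) (SetArr 4 (Reg 9) (Reg 10)))
    Skip.

Definition round : com :=
  Seq (SetReg 8 (Lit 0))
    (Seq (SetReg 6 (Lit 0))
      (Seq (for_loop 5
             (Seq (for_loop 7 scan_edge) (SetReg 6 (Add (Reg 6) (Reg 0)))))
        settle_best)).

(** The path may overwrite array 0, which is where it has to be delivered,
    because the adjacency matrix is no longer needed.  Register 11 holds the
    current node and 12 the number of nodes written. *)
Definition write_path : com :=
  Seq (SetReg 11 (Reg 1))
    (Seq (SetReg 12 (Lit 0))
      (Seq (While (gap (Reg 11) (Reg 2))
             (Seq (SetArr 0 (Reg 12) (Reg 11))
               (Seq (SetReg 12 (Add (Reg 12) (Lit 1)))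
                 (SetReg 11 (Get 4 (Reg 11))))))
        (Seq (SetArr 0 (Reg 12) (Reg 2))
          (SetReg 0 (Add (Reg 12) (Lit 1)))))).

Definition dijkstra : com :=
  Seq (SetArr 3 (Reg 2) (Lit 1)) (Seq (for_loop 4 round) write_path).

(** The flag is set exactly when a shortest path for the metropolitan weight has
    weight 0, so one shortest-path computation does for both phases. *)
Definition choose_weight : com :=
  If (gap (Reg 1) (Reg 2))
    (SetReg 3 (Sub (Add (Get 2 (Reg 1)) (Get 2 (Reg 2))) (Lit 1)))
    (SetReg 3 (Lit 1)).

Definition algorithm : com := Seq choose_weight dijkstra.

(** * Correctness of Dijkstra's algorithm *)
Section Dijkstra.
Context (V : finType) (e : rel V) (zone : V -> nat) (M : {set V}) (F : bool).
Context (x y : V).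
Context (w : V -> V -> nat).
Hypothesis conn : forall u, connect e u y.
Hypothesis wE : forall u v,
  w u v = if F then ~~ ((u \in M) && (v \in M)) else zone u != zone v.

Record holds_instance (s : state) : Prop := HoldsInstance {
  inst_n : reg s 0 = #|V|;
  inst_x : reg s 1 = code x;
  inst_y : reg s 2 = code y;
  inst_F : reg s 3 = F;
  inst_e : forall u v, arr s 0 (code u * #|V| + code v) = e u v;
  inst_zone : forall v, arr s 1 (code v) = zone v;
  inst_M : forall v, arr s 2 (code v) = (v \in M) }.

Lemma holds_instance_set_reg r v s :
  3 < r -> holds_instance s -> holds_instance (set_reg s r v).
Proof. by case: r => [|[|[|[|r]]]] // _ []; split. Qed.

Lemma holds_instance_set_arr a i v s :
  2 < a -> holds_instance s -> holds_instance (set_arr s a i v).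
Proof. by case: a => [|[|[|a]]] // _ []; split. Qed.

Lemma code_inj : injective (@code V).
Proof. by move=> u v; apply: index_inj; rewrite ?mem_enum. Qed.

Lemma code_lt (v : V) : code v < #|V|.
Proof. by rewrite cardE index_mem mem_enum. Qed.

Lemma code_onto i : i < #|V| -> exists v : V, code v = i.
Proof.
rewrite cardE => lti; exists (nth y (enum V) i).
by rewrite /code index_uniq ?enum_uniq.
Qed.

Lemma eval_edge_weight s u v :
    holds_instance s -> reg s 5 = code u -> reg s 7 = code v ->
  eval s edge_weight = w u v.
Proof.
move=> I u5 v7.
rewrite /edge_weight /= u5 v7 !(inst_M I) !(inst_zone I) (inst_F I) wE.
by case: F; case: (u \in M); case: (v \in M) => //=; lia.
Qed.

(** The list obtained by following successors from a settled node.  Every node on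
    it is settled, so settling further nodes does not disturb it. *)
Inductive trace (D N : nat -> nat) : V -> seq V -> Prop :=
| TraceTarget : trace D N y [:: y]
| TraceStep v u l :
    v != y -> D (code v) != 0 -> N (code v) = code u -> e v u ->
    trace D N u l -> trace D N v (v :: l).

Lemma trace_path D N v l : trace D N v l -> xy_path e v y l.
Proof.
elim=> {v l} [|v u l _ _ _ evu _ /xy_pathP[q -> [eq lq]]].
  by apply/xy_pathP; exists [::].
by apply/xy_pathP; exists (u :: q); rewrite //= evu eq lq.
Qed.

(** The invariant of Dijkstra's algorithm after [k] rounds.  The bound on the
    length of traces limits the time for writing the path, and the last clause
    guarantees that [#|V|] rounds suffice. *)
Record settled (k : nat) (D N : nat -> nat) : Prop := Settled {
  settled_target : D (code y) = 1;
  settled_trace v : D (code v) != 0 ->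
    exists l, [/\ trace D N v l, size l <= k.+1
                & D (code v) = (path_weight w l).+1];
  settled_min v W : D (code v) != 0 -> xy_path e v y W ->
    D (code v) <= (path_weight w W).+1;
  settled_count :
    k < #|[set v : V | D (code v) != 0]| \/ forall v : V, D (code v) != 0 }.

Definition crossing (D : nat -> nat) (u v : V) : bool :=
  [&& e u v, D (code u) == 0 & D (code v) != 0].

(** The edge [(i, j)] minimizes the value [b] among the edges in [seen] that lead
    from an unsettled to a settled node; [b = 0] encodes that there is none. *)
Record best_crossing (seen : rel V) (D : nat -> nat) (b i j : nat) : Prop :=
  BestCrossing {
  best_attained : b != 0 -> exists u v,
    [/\ i = code u, j = code v, crossing D u v & b = D (code v) + w u v];
  best_min u v : seen u v -> crossing D u v -> 0 < b <= D (code v) + w u v }.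

(** The heart of Dijkstra's algorithm: a path from an unsettled node to the target
    uses an edge from an unsettled to a settled node, and from there on it is at
    least as long as the known distance.  In particular a crossing edge exists as
    long as some node is unsettled. *)
Lemma crossing_bound k D N b i j u W :
    settled k D N -> best_crossing (fun _ _ => true) D b i j ->
    D (code u) = 0 -> xy_path e u y W ->
  0 < b <= (path_weight w W).+1.
Proof.
move=> st best u0; case/xy_pathP=> q -> [+ +].
elim: q u u0 => [|v q IH] u u0 /=.
  by move=> _ uy; have := settled_target st; rewrite -uy u0.
rewrite path_weight_cons => /andP[euv eq] lq.
have [v0|v1] := eqVneq (D (code v)) 0; first by have := IH v v0 eq lq; lia.
have := best_min best (u := u) (v := v) isT; rewrite /crossing euv u0 v1 eqxx.
have vq : xy_path e v y (v :: q) by apply/xy_pathP; exists q.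
by have := settled_min st v1 vq; move=> le /(_ isT); lia.
Qed.

Lemma settled_init D N :
    D (code y) = 1 -> (forall i, i != code y -> D i = 0) -> settled 0 D N.
Proof.
move=> y1 D0; have Dy v : (D (code v) != 0) = (v == y).
  by have [->|/eqP vy] := eqVneq v y; rewrite ?y1 // D0 //; apply/eqP => /code_inj.
split=> // [v|v W|].
- rewrite Dy => /eqP->; exists [:: y]; split=> //; first exact: TraceTarget.
  by rewrite y1 path_weight1.
- by rewrite Dy => /eqP->; rewrite y1.
by left; rewrite card_gt0; apply/set0Pn; exists y; rewrite inE Dy.
Qed.

Lemma trace_settle D N D' N' :
    (forall i, D i != 0 -> D' i = D i /\ N' i = N i) ->
  forall v l, trace D N v l -> trace D' N' v l.
Proof.
move=> same v l; elim=> {v l} [|v u l vy v1 Nv evu _ IH].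
  exact: TraceTarget.
have [Dv' Nv'] := same _ v1.
by apply: (TraceStep (u := u)); rewrite ?Dv' ?Nv'.
Qed.

(** If [b = 0] then every node is settled, because the network is connected; the
    round changes nothing and the invariant persists. *)
Lemma settled_step k D N D' N' b i j :
    settled k D N -> best_crossing (fun _ _ => true) D b i j ->
    (forall a, D' a = if (b != 0) && (a == i) then b else D a) ->
    (forall a, N' a = if (b != 0) && (a == i) then j else N a) ->
  settled k.+1 D' N'.
Proof.
move=> st best DE NE; have [b0|bN0] := eqVneq b 0.
  have all1 (v : V) : D (code v) != 0.
    apply/negP => /eqP v0; case/connectP: (conn v) => q eq lq.
    have vq : xy_path e v y (v :: q) by apply/xy_pathP; exists q.
    by have := crossing_bound st best v0 vq; rewrite b0.
  have D'E a : D' a = D a by rewrite DE b0.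
  split=> [|v|v W|]; rewrite ?D'E; first exact: (settled_target st).
  - move=> v1; have [l [tl sl wl]] := settled_trace st v1; exists l; split=> //.
      by apply: trace_settle tl => a _; rewrite DE NE b0.
    by rewrite (leq_trans sl).
  - exact: (settled_min st).
  by right=> v; rewrite D'E.
rewrite bN0 /= in DE NE.
have [u [v [iu jv /and3P[euv /eqP u0 v1] bE]]] := best_attained best bN0.
have u_bound W := crossing_bound (W := W) st best u0.
have D'u : D' i = b by rewrite DE eqxx.
have D'E t : t != u -> D' (code t) = D (code t).
  by move=> tu; rewrite DE iu (inj_eq code_inj) (negPf tu).
(* Only the entry of the newly settled node [u] changes. *)
have same a : D a != 0 -> D' a = D a /\ N' a = N a.
  by rewrite DE NE; case: (eqVneq a i) => // ->; rewrite iu u0.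
have yu : y != u.
  by apply/eqP => yu; have := settled_target st; rewrite yu u0.
split=> [|t|t W|].
- by rewrite D'E // (settled_target st).
- have [->|tu] := eqVneq t u; last first.
    rewrite D'E // => /(settled_trace st) [l [tl sl wl]].
    by exists l; split=> //; [apply: trace_settle tl | apply: leq_trans sl _].
  move=> _; have [l [tl sl wl]] := settled_trace st v1; exists (u :: l).
  split=> //.
    apply: (TraceStep (u := v)) => //; last exact: trace_settle tl.
    + by rewrite eq_sym.
    + by rewrite -iu D'u.
    by rewrite NE iu eqxx.
  rewrite -iu D'u bE wl; have /xy_pathP[q -> _] := trace_path tl.
  by rewrite path_weight_cons; lia.
- have [->|tu] := eqVneq t u; last by rewrite D'E //; apply: (settled_min st).
  by move=> _ /u_bound /andP[_]; rewrite -iu D'u.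
case: (settled_count st) => [lt|all1]; last by have := all1 u; rewrite u0.
left; apply: leq_ltn_trans lt _; apply: proper_card; apply/properP; split.
  apply/subsetP => t; rewrite !inE => t1.
  by have [-> _] := same _ t1.
by exists u; rewrite !inE ?u0 // -iu D'u.
Qed.

Lemma best_crossing_skip (seen seen' : rel V) D b i j u0 v0 :
    (forall u v, seen' u v -> seen u v \/ u = u0 /\ v = v0) ->
    (crossing D u0 v0 -> 0 < b <= D (code v0) + w u0 v0) ->
    best_crossing seen D b i j ->
  best_crossing seen' D b i j.
Proof.
move=> sub new [att minb]; split=> // u v /sub[/minb//|[-> ->]].
exact: new.
Qed.

Lemma best_crossing_improve (seen seen' : rel V) D b i j u0 v0 :
    (forall u v, seen' u v -> seen u v \/ u = u0 /\ v = v0) ->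
    crossing D u0 v0 -> b = 0 \/ D (code v0) + w u0 v0 < b ->
    best_crossing seen D b i j ->
  best_crossing seen' D (D (code v0) + w u0 v0) (code u0) (code v0).
Proof.
move=> sub new better [_ minb]; have /and3P[_ _ v1] := new.
split=> [_|u v /sub[seenuv cuv|[-> ->] _]]; first by exists u0, v0.
  by have := minb _ _ seenuv cuv; lia.
by rewrite leqnn andbT; lia.
Qed.

Record scanning (k i : nat) (seen : rel V) (s : state) : Prop := Scanning {
  scan_inst : holds_instance s;
  scan_settled : settled k (arr s 3) (arr s 4);
  scan_round : reg s 4 = k;
  scan_row : reg s 5 = i;
  scan_base : reg s 6 = i * #|V|;
  scan_best : best_crossing seen (arr s 3) (reg s 8) (reg s 9) (reg s 10) }.

(** Pairs are scanned in row-major order. *)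
Definition seen_rows (i : nat) : rel V := fun u _ => code u < i.
Definition seen_cells (i j : nat) : rel V :=
  fun u v => (code u < i) || (code u == i) && (code v < j).

Lemma runs_scan_edge k i j s :
    i < #|V| -> j < #|V| -> scanning k i (seen_cells i j) s -> reg s 7 = j ->
  runs scan_edge 200 s
    (fun s' => reg s' 7 = j /\ scanning k i (seen_cells i j.+1) s').
Proof.
move=> /code_onto[u <-] /code_onto[v <-] sc v7.
have [I st k4 u5 base best] := sc.
have next a b : seen_cells (code u) (code v).+1 a b ->
    seen_cells (code u) (code v) a b \/ a = u /\ b = v.
  rewrite /seen_cells ltnS [code b <= _]leq_eqVlt !(inj_eq code_inj).
  by case: eqVneq => [->|]; case: eqVneq => [->|]; auto.
have skip : (crossing (arr s 3) u v ->
      0 < reg s 8 <= arr s 3 (code v) + w u v) ->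
    reg s 7 = code v /\ scanning k (code u) (seen_cells (code u) (code v).+1) s.
  by move=> H; split=> //; split=> //; apply: best_crossing_skip H best.
apply: runs_time.
  rewrite /scan_edge; apply: runs_if => [|E0]; last first.
    apply: runs_skip; apply: skip => /and3P[euv _ _].
    by move: E0; rewrite /= base v7 (inst_e I) euv.
  rewrite /= base v7 (inst_e I) => /eqP; rewrite eqb0 negbK => euv.
  apply: runs_if => [|/= u0].
    rewrite /= u5 => /eqP u1.
    by apply: runs_skip; apply: skip => /and3P[_ u0 _]; case/negP: u1.
  rewrite u5 in u0.
  apply: runs_if => [/=|/= v0]; last first.
    by apply: runs_skip; apply: skip => /and3P[_ _]; rewrite -v7 v0.
  rewrite v7 => /eqP v1.
  have cuv : crossing (arr s 3) u v by rewrite /crossing euv u0 eqxx.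
  apply: runs_seq; apply: runs_set_reg.
  set s1 := set_reg s 13 _.
  have s1E : reg s1 13 = arr s 3 (code v) + w u v.
    by rewrite /s1 -(eval_edge_weight I u5 v7) /= v7.
  apply: runs_if => [c1|c0].
    have {}c1 : 1 - reg s 8 + (reg s 8 - reg s1 13) <> 0 := c1.
    rewrite s1E in c1.
    do 2 (apply: runs_seq; apply: runs_set_reg); apply: runs_set_reg.
    split=> //; split=> //; first by do 4 apply: holds_instance_set_reg => //.
    change (best_crossing (seen_cells (code u) (code v).+1)
      (arr s 3) (reg s1 13) (reg s 5) (reg s 7)).
    by rewrite s1E u5 v7; apply: best_crossing_improve next cuv _ best; lia.
  apply: runs_skip; split=> //; split=> //.
    exact: holds_instance_set_reg.
  apply: best_crossing_skip next _ best.
  have {}c0 : 1 - reg s 8 + (reg s 8 - reg s1 13) = 0 := c0.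
  by move=> _; rewrite s1E in c0; lia.
by [].
Qed.

Lemma runs_scan_row k i s :
    i < #|V| -> scanning k i (seen_rows i) s ->
  runs (for_loop 7 scan_edge) (#|V| * (200 + 9) + 7) s
    (scanning k i (seen_rows i.+1)).
Proof.
move=> ltin sc.
pose Inv j s := reg s 7 = j /\ scanning k i (seen_cells i j) s.
apply: (@runs_weaken _ _ _ _ (Inv #|V|)); first exact: leqnn.
  move=> s' [_ [I st k4 i5 base best]]; split=> //.
  case: best => att minb; split=> // u v seen; apply: minb.
  move: seen; rewrite /seen_rows /seen_cells ltnS leq_eqVlt orbC code_lt andbT.
  by [].
apply: runs_for.
- by move=> j s1 [v7 [[]]].
- have [I st k4 i5 base best] := sc; split=> //; split=> //.
    exact: holds_instance_set_reg.
  case: best => att minb; split=> // u v seen; apply: minb.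
  by move: seen; rewrite /seen_rows /seen_cells andbF orbF.
move=> j s1 ltjn [v7 {}sc].
apply: runs_weaken (runs_scan_edge ltin ltjn sc v7) => // s2.
case=> v72 [I st k4 i5 base best]; split=> //; split=> //; split=> //.
exact: holds_instance_set_reg.
Qed.

Lemma runs_round k s :
    holds_instance s -> reg s 4 = k -> settled k (arr s 3) (arr s 4) ->
  runs round (#|V| * (#|V| * 209 + 21) + 50) s
    (fun s' => [/\ holds_instance s', reg s' 4 = k
                 & settled k.+1 (arr s' 3) (arr s' 4)]).
Proof.
move=> I k4 st.
apply: runs_time.
  do 2 (apply: runs_seq; apply: runs_set_reg); apply: runs_seq.
  apply: (@runs_weaken _ (#|V| * (#|V| * 209 + 12 + 9) + 7) _ _
            (scanning k #|V| (seen_rows #|V|))) => //; last first.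
    apply: (@runs_for _ _ _ _ _ (fun i => scanning k i (seen_rows i))).
    - by move=> i s1 [[]].
    - by split=> //; do 3 apply: holds_instance_set_reg => //.
    move=> i s1 ltin sc; apply: runs_time.
    - apply: runs_seq; apply: (runs_weaken (leqnn _) _ (runs_scan_row ltin sc)).
      move=> s2 [I2 st2 k2 i2 base2 best2]; apply: runs_set_reg.
      split; first exact: i2.
      split=> //; first by do 2 apply: holds_instance_set_reg => //.
      by rewrite /= base2 (inst_n I2) mulSn addnC.
    by rewrite /=; lia.
  move=> s1 [I1 st1 k1 i1 base1 best1].
  have {}best1 : best_crossing (fun _ _ => true) (arr s1 3) (reg s1 8) (reg s1 9)
      (reg s1 10).
    by case: best1 => att minb; split=> // u v _; apply: minb; apply: code_lt.
  rewrite /settle_best; apply: runs_if => [/= /eqP b1|/= b0].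
    apply: runs_seq; do 2 apply: runs_set_arr.
    split=> //; first by do 2 apply: holds_instance_set_arr => //.
    by apply: settled_step st1 best1 _ _ => a /=; rewrite b1.
  apply: runs_skip; split=> //.
  by apply: settled_step st1 best1 _ _ => a /=; rewrite b0.
by rewrite /=; lia.
Qed.

(** Appending to an array does not touch the part already written. *)
Lemma mkseq_write (f : nat -> nat) b m :
  mkseq (fun i => if i == m then b else f i) m = mkseq f m.
Proof.
by apply/eq_in_map => i; rewrite mem_iota /= => ltim; rewrite (ltn_eqF ltim).
Qed.

Lemma runs_write_path s l :
    holds_instance s -> trace (arr s 3) (arr s 4) x l ->
  runs write_path (25 * size l + 40) s (fun s' => outputs s' l).
Proof.
move=> I tl.
apply: runs_time.
  do 2 (apply: runs_seq; apply: runs_set_reg); apply: runs_seq.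
  pose D := arr s 3; pose N := arr s 4.
  pose Inv (done : seq nat) (v : V) s' := [/\ reg s' 2 = code y,
    reg s' 11 = code v, reg s' 12 = size done,
    arr s' 4 = N & mkseq (arr s' 0) (size done) = done].
  suff loop v l' done s' : trace D N v l' -> Inv done v s' ->
      runs (While (gap (Reg 11) (Reg 2))
             (Seq (SetArr 0 (Reg 12) (Reg 11))
               (Seq (SetReg 12 (Add (Reg 12) (Lit 1)))
                 (SetReg 11 (Get 4 (Reg 11)))))) (25 * size l') s'
        (fun s'' => exists done', Inv done' y s'' /\
           done ++ map (@code V) l' = rcons done' (code y)).
    apply: runs_weaken; last first.
    - apply: (loop x l [::]) => //; split=> //=; rewrite ?(inst_x I) //.
      exact: (inst_y I).
    - move=> s1 [done [[y2 _ len _ out] eq]].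
      apply: runs_seq; apply: runs_set_arr; apply: runs_set_reg.
      rewrite /outputs -[map _ l]/([::] ++ map _ l) eq /= len addn1.
      by rewrite mkseqS /= eqxx y2 mkseq_write out.
    exact: leqnn.
  move=> tr; elim: tr done s' => {v l'} [|v u l' vy v1 Nv evu _ IH] done s'.
    move=> inv; have [y2 v11 _ _ _] := inv.
    apply: (@runs_time _ 8) => //.
    apply: (runs_while_stop (E := gap _ _)); first by rewrite /= y2 v11 subnn.
    by exists done; split=> //; rewrite cats1.
  move=> [y2 v11 len N4 out].
  apply: runs_time.
    apply: (runs_while_step (E := gap _ _)).
      by apply/eqP; rewrite eval_gap /= y2 v11 (inj_eq code_inj).
    apply: runs_seq; apply: runs_set_arr; apply: runs_seq.
    do 2 apply: runs_set_reg.
    apply: runs_weaken (IH (rcons done (code v)) _ _); first exact: leqnn.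
      by move=> s'' [done' []]; exists done'; rewrite -cat_rcons.
    split=> //=; rewrite ?N4 ?v11 // ?size_rcons ?len ?addn1 //.
    by rewrite mkseqS /= eqxx mkseq_write out.
  by rewrite /=; lia.
by rewrite /=; lia.
Qed.

Lemma runs_dijkstra s :
    holds_instance s -> (forall i, arr s 3 i = 0) ->
  runs dijkstra (#|V| * (#|V| * (#|V| * 209 + 21) + 85) + 77) s
    (fun s' => exists2 W, outputs s' W & shortest_path e w x y W).
Proof.
move=> I D0; apply: runs_time.
  apply: runs_seq; apply: runs_set_arr; apply: runs_seq.
  pose Inv k s' := [/\ holds_instance s', reg s' 4 = k
                      & settled k (arr s' 3) (arr s' 4)].
  apply: (@runs_weaken _ _ _ _ (Inv #|V|)); last first.
    apply: runs_for.
    - by move=> k s1 [I1 k1 _]; rewrite (inst_n I1).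
    - split=> //.
        by apply: holds_instance_set_reg => //; apply: holds_instance_set_arr.
      apply: settled_init => [|i] /=; rewrite (inst_y I) ?eqxx //.
      by move=> /negPf->; exact: D0.
    move=> k s1 _ [I1 k1 st1]; apply: runs_weaken (runs_round I1 k1 st1) => //.
    move=> s2 [I2 k2 st2]; split=> //; split=> //.
    exact: holds_instance_set_reg.
  move=> s1 [I1 _ st1].
  have x1 : arr s1 3 (code x) != 0.
    by case: (settled_count st1) => // /leq_trans /(_ (max_card _)); rewrite ltnn.
  have [l [tl sl wl]] := settled_trace st1 x1.
  (* The trace has at most [#|V|.+1] nodes. *)
  apply: (runs_weaken _ _ (runs_write_path I1 tl)).
    by apply: (leq_trans _ (leqnn (25 * #|V|.+1 + 40))); lia.
  move=> s2 out; exists l => //; split=> [|W xyW]; first exact: trace_path tl.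
  by have := settled_min st1 x1 xyW; rewrite wl ltnS.
- exact: leqnn.
by rewrite /=; lia.
Qed.

End Dijkstra.

(** * The program on encoded instances *)
Lemma nth_allpairs (S T : Type) (f : S -> T -> nat) x0 y0 s t i j :
    i < size s -> j < size t ->
  nth 0 [seq f a b | a <- s, b <- t] (i * size t + j) =
    f (nth x0 s i) (nth y0 t j).
Proof.
elim: s i => // a s IH [_|i lti] ltj; rewrite allpairs_cons nth_cat size_map.
  by rewrite ltj (nth_map y0).
by rewrite ltnNge mulSn -addnA leq_addr /= addKn IH.
Qed.

Section Main.
Context (V : finType) (e : rel V) (Z : {set {set V}}) (ZM : {set V}) (x y : V).
Hypothesis part : zone_partition Z.
Let zone (v : V) := index (pblock Z v) (enum Z).
Let F := (x == y) || (x \in ZM) && (y \in ZM).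

Lemma nth_code (S : Type) (f : V -> S) x0 v :
  nth x0 (map f (enum V)) (code v) = f v.
Proof. by rewrite (nth_map v) ?nth_index ?mem_enum // -cardE code_lt. Qed.

Lemma border_weightE u v : border_weight Z u v = (zone u != zone v).
Proof.
have [coverZ _ _] := and3P part.
have inZ a : pblock Z a \in enum Z.
  by rewrite mem_enum pblock_mem // (eqP coverZ) inE.
rewrite /border_weight /zone; case: eqP => [->|neq]; first by rewrite eqxx.
by case: eqP => // same; case: neq; apply: (index_inj set0 (inZ u) (inZ v) same).
Qed.

Lemma runs_choose_weight :
  runs choose_weight 30 (input e Z ZM x y) (fun s =>
    holds_instance e zone ZM F x y s /\ forall i, arr s 3 i = 0).
Proof.
have I : holds_instance e zone ZM F x y (set_reg (input e Z ZM x y) 3 F).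
  split=> // [u v|v|v]; rewrite /=; try exact: nth_code.
  rewrite cardE (nth_allpairs _ u v) -?cardE ?code_lt //.
  by rewrite /code !nth_index ?mem_enum.
have D0 i : arr (set_reg (input e Z ZM x y) 3 F) 3 i = 0 by exact: nth_nil.
apply: runs_time.
  apply: runs_if => [/eqP|/eqP]; rewrite eval_gap /= (inj_eq (@code_inj V)) => xy.
    apply: runs_set_reg; rewrite /= !nth_code.
    suff -> : (x \in ZM) + (y \in ZM) - 1 = F by [].
    by rewrite /F (negPf xy); case: (x \in ZM); case: (y \in ZM).
  have F1 : F = 1 :> nat by rewrite /F xy.
  by rewrite F1 in I D0; apply: runs_set_reg.
by [].
Qed.

(** The cubic comes from [#|V|] rounds, each of which scans all pairs of nodes. *)
Lemma runs_algorithm :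
    (forall u v, connect e u v) -> metropolitan_zone e Z ZM ->
  runs algorithm (#|V| * (#|V| * (#|V| * 209 + 21) + 85) + 109) (input e Z ZM x y)
    (fun s => exists2 W, outputs s W & algorithm_returns e Z ZM x y W).
Proof.
move=> conn metro.
pose w := if F then metropolitan_weight ZM else border_weight Z.
have wE u v : w u v =
    if F then ~~ ((u \in ZM) && (v \in ZM)) else zone u != zone v.
  rewrite /w; case: ifP => _; rewrite ?border_weightE //.
  by rewrite /metropolitan_weight; case: ifP.
apply: runs_time.
  apply: runs_seq; apply: runs_weaken runs_choose_weight; first exact: leqnn.
  move=> s1 [I D0]; apply: runs_weaken (runs_dijkstra _ wE I D0) => //.
  move=> s2 [W out shW]; exists W => //; move: shW; rewrite /w.
  case: (boolP F) => [FT|/negbTE FF] shW.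
    apply: ReturnMetropolitan (shW) _; apply/eqP.
    by rewrite (shortest_metropolitan_weight0 metro shW).
  have [W0 shW0] := shortest_path_exists (metropolitan_weight ZM) (conn x y).
  apply: ReturnZone (shW0) _ shW; apply/eqP.
  by rewrite (shortest_metropolitan_weight0 metro shW0) -/F FF.
by rewrite addnC; lia.
Qed.

End Main.

Local Open Scope ring_scope.

Theorem corollary29 :
  exists (prog : com) (q : {poly nat}),
  forall (R : realType) (V : finType) (e : rel V) (Z : {set {set V}})
    (ZM : {set V}) (P : nat -> R) (PM : R) (x y : V),
  ptn e ->
  zone_partition Z ->
  metropolitan_zone e Z ZM ->
  increasing_price P ->
  nonneg_price P ->
  0 <= PM ->
  no_stopover e (basic_zone_tariff Z P) ->
  let p := metropolitan_tariff Z ZM P PM in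
  [/\ exists (t : nat) (s : state) (W : seq V),
        [/\ exec prog (input e Z ZM x y) t s,
            (t <= q.[#|V|])%N,
            outputs s W
          & algorithm_returns e Z ZM x y W],
      PM <= P 3%N ->
        forall W, algorithm_returns e Z ZM x y W ->
          cheapest_path e p x y W /\
          cheapest_standard_ticket e p x y (standard_ticket W)
    & PM <= P 2%N -> no_stopover e p ->
        forall W, algorithm_returns e Z ZM x y W ->
          cheapest_ticket e p x y (standard_ticket W)].
Proof.
(* The time bound of [runs_algorithm] in Horner form. *)
exists algorithm, (((209%N%:P * 'X + 21%N%:P) * 'X + 85%N%:P) * 'X + 109%N%:P).
move=> R V e Z ZM P PM x y [_ _ conn] part metro incP geP PM0 _ p; split.
- have [t [s [ex tT [W out alg]]]] := runs_algorithm x y part conn metro.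
  exists t, s, W; split=> //; apply: leq_trans tT _.
  by rewrite !(hornerD, hornerMX, hornerC) /=; lia.
- move=> PM3 W algW.
  have cheap := price_cheapest part metro incP PM3 algW; split=> //.
  have [xyW minW] := cheap; split; first by exists W.
  by move=> W' /minW; rewrite /ticket_price !big_seq1.
by move=> PM2 nsp W; apply: price_cheapest_ticket.
Qed.
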